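(* Let $n\ge 1$ and consider a mixture of $n$ materially uniform constituents on a body manifold $\mathcal B$, with (transitive) material groupoids ${\mathcal Z}_i\rightrightarrows{\mathcal B}$, $i=1,\dots,n$. Then the mixture is materially uniform if, and only if, the core of its material $n$-groupoid is transitive.
   Context: A body manifold $\mathcal B$ is a smooth 3-dimensional manifold. The 1-jet groupoid of $\mathcal B$ has object set $\mathcal B$, and its arrows from $X$ to $Y$ are the 1-jets at $X$ of local diffeomorphisms sending $X$ to $Y$, equivalently linear isomorphisms $T_X{\mathcal B}\to T_Y{\mathcal B}$, composed as maps. The material response of a constituent is given by constitutive equations. A material isomorphism of that constituent from $X$ to $Y$ is a linear isomorphism between the first-order neighbourhoods of $X$ and $Y$ (an arrow of the 1-jet groupoid) that renders the material responses at the two points indistinguishable. The material groupoid ${\mathcal Z}_i\rightrightarrows{\mathcal B}$ of the $i$-th constituent is the subgroupoid of the 1-jet groupoid whose arrows are the material isomorphisms of the $i$-th constituent. The constituent is materially uniform if, and only if, ${\mathcal Z}_i$ is transitive (there is at least one arrow from $X$ to $Y$ for all $X,Y\in{\mathcal B}$). A material isomorphism of the mixture from $X$ to $Y$ is an arrow of the 1-jet groupoid from $X$ to $Y$ that is simultaneously a material isomorphism of every one of the $n$ constituents. The mixture is materially uniform if for all $X,Y\in{\mathcal B}$ there is a material isomorphism of the mixture from $X$ to $Y$. An objective $n$-skeleton arising from ${\mathcal Z}_1,\dots,{\mathcal Z}_n$ consists of a map $W:\{0,1\}^n\to{\mathcal B}$ (not necessarily injective) together with an assignment, to each $I\in\{1,\dots,n\}$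 and each $v\in\{0,1\}^n$ with $v_I=0$, of an arrow $g_{v,I}\in{\mathcal Z}_I$ with source $W(v)$ and target $W(v+e_I)$, where $e_I$ is the $I$-th standard unit vector; this arrow is the weight of the oriented edge $v\to v+e_I$. A 2-face, given by distinct $I,J$ and $v$ with $v_I=v_J=0$, is commutative if $g_{v+e_I,J}\circ g_{v,I}=g_{v+e_J,I}\circ g_{v,J}$. The material $n$-groupoid of the mixture is the set of all objective $n$-skeletons arising from ${\mathcal Z}_1,\dots,{\mathcal Z}_n$ all of whose 2-faces are commutative (equivalently, for which the composed weight around every circuit of edges is the identity). It carries the $n$ groupoid structures $\odot_I$ given by gluing two skeletons along a common facet perpendicular to the $I$-th coordinate and composing the corresponding edges in ${\mathcal Z}_I$. The core of the material $n$-groupoid is the groupoid over $\mathcal B$ whose arrows are the elements of the material $n$-groupoid in which every edge other than the $n$ edges issuing from the vertex $W_0=W(0,\dots,0)$ is a unit of the corresponding groupoid. In such an element all vertices other than $W_0$ are one and the same point $Y$ of $\mathcal B$, and the element is regarded as an arrow from $W_0$ to $Y$. The core is transitive if for all $X,Y\in{\mathcal B}$ it contains an arrow from $X$ to $Y$. *)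

(* Defs.v *)
From HB Require Import structures.
From mathcomp Require Import all_boot all_order all_algebra.
From mathcomp Require Import all_classical all_reals all_analysis.

Set Implicit Arguments.
Unset Strict Implicit.
Unset Printing Implicit Defensive.

Import Order.TTheory GRing.Theory Num.Theory.
Import numFieldNormedType.Exports.

Local Open Scope classical_set_scope.
Local Open Scope ring_scope.

Fixpoint Ck_on (R : realType) (k : nat) (U : set 'rV[R]_3)
    (f : 'rV[R]_3 -> 'rV[R]_3) : Prop :=
  if k is k'.+1 then
    (forall x, U x -> differentiable f x) /\
    (forall v, Ck_on k' U (fun x => 'D_v f x))
  else forall x, U x -> {for x, continuous f}.

(* Only used with U open. *)
Definition smooth_on (R : realType) (U : set 'rV[R]_3)
    (f : 'rV[R]_3 -> 'rV[R]_3) : Prop :=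
  forall k, Ck_on k U f.

(* The values of [chart_map] off [chart_dom], and of [chart_inv] off the image
   of [chart_dom], are irrelevant. *)
Record chart (R : realType) (M : topologicalType) := Chart {
  chart_dom : set M ;
  chart_map : M -> 'rV[R]_3 ;
  chart_inv : 'rV[R]_3 -> M ;
  chart_dom_open : open chart_dom ;
  chart_img_open : open (chart_map @` chart_dom) ;
  chart_mapK : forall x, chart_dom x -> chart_inv (chart_map x) = x ;
  chart_map_continuous : forall x, chart_dom x -> {for x, continuous chart_map} ;
  chart_inv_continuous : forall p, (chart_map @` chart_dom) p ->
    {for p, continuous chart_inv} }.

Definition transition (R : realType) (M : topologicalType) (a b : chart R M)
  : 'rV[R]_3 -> 'rV[R]_3 := chart_map b \o chart_inv a.

(* The smooth structure is the one generated by the (not necessarily maximal)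
   atlas. *)
Record body_manifold (R : realType) := BodyManifold {
  body_carrier :> topologicalType ;
  body_hausdorff : hausdorff_space body_carrier ;
  body_second_countable : @second_countable body_carrier ;
  atlas : set (chart R body_carrier) ;
  atlas_cover : forall X : body_carrier, exists2 a, atlas a & chart_dom a X ;
  atlas_compatible : forall a b, atlas a -> atlas b ->
    smooth_on (chart_map a @` (chart_dom a `&` chart_dom b)) (transition a b) }.

Section TangentSpace.
Variables (R : realType) (B : body_manifold R) (X : B).

Definition charts_at : Type :=
  {a : chart R B | atlas a /\ chart_dom a X}.

(* A tangent vector at X is the family of its coordinate representatives in the
   charts around X, transforming by the Jacobians of the transition maps. *)
Definition tangent_family (v : charts_at -> 'rV[R]_3) : bool :=
  `[< forall a b : charts_at,
        v b = 'd (transition (sval a) (sval b))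
                 (chart_map (sval a) X) (v a) >].

Lemma tangent_family_submod_closed : submod_closed tangent_family.
Proof.
split; first by apply/asboolP => a b; rewrite linear0.
by move=> k u v /asboolP hu /asboolP hv; apply/asboolP => a b;
  rewrite linearP /= -hu -hv.
Qed.

HB.instance Definition _ :=
  GRing.isSubmodClosed.Build R (charts_at -> 'rV[R]_3) tangent_family
    tangent_family_submod_closed.

Record tangent := Tangent {
  tangent_val :> charts_at -> 'rV[R]_3 ;
  tangentP : tangent_val \in tangent_family }.

HB.instance Definition _ := [isSub of tangent for tangent_val].
HB.instance Definition _ := [Choice of tangent by <:].
HB.instance Definition _ := [SubChoice_isSubZmodule of tangent by <:].
HB.instance Definition _ := [SubZmodule_isSubLmodule of tangent by <:].

End TangentSpace.

(* [gcomp g f] is g after f. *)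
Record groupoid (B : Type) := Groupoid {
  arr : B -> B -> Type ;
  gid : forall X, arr X X ;
  gcomp : forall X Y Z, arr Y Z -> arr X Y -> arr X Z ;
  ginv : forall X Y, arr X Y -> arr Y X ;
  gcomp1l : forall X Y (f : arr X Y), gcomp (gid Y) f = f ;
  gcomp1r : forall X Y (f : arr X Y), gcomp f (gid X) = f ;
  gcompA : forall X Y Z T (h : arr Z T) (g : arr Y Z) (f : arr X Y),
    gcomp h (gcomp g f) = gcomp (gcomp h g) f ;
  gcompVl : forall X Y (f : arr X Y), gcomp (ginv f) f = gid X ;
  gcompVr : forall X Y (f : arr X Y), gcomp f (ginv f) = gid Y }.

Arguments gid {B} _ X.

Record subgroupoid (B : Type) (G : groupoid B) := Subgroupoid {
  subarr :> forall X Y, set (arr G X Y) ;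
  sub_gid : forall X, subarr (gid G X) ;
  sub_gcomp : forall X Y Z (g : arr G Y Z) (f : arr G X Y),
    subarr g -> subarr f -> subarr (gcomp g f) ;
  sub_ginv : forall X Y (f : arr G X Y), subarr f -> subarr (ginv f) }.

Definition is_transitive (B : Type) (A : B -> B -> Type)
    (Z : forall X Y, set (A X Y)) : Prop :=
  forall X Y, exists g, Z X Y g.

(* An arrow bundled with its source and target, so that arrows whose endpoints
   are only propositionally equal can be compared. *)
Definition bundle (B : Type) (G : groupoid B) (X Y : B) (g : arr G X Y)
  : {XY : B * B & arr G XY.1 XY.2} :=
  existT (fun XY : B * B => arr G XY.1 XY.2) (X, Y) g.

Lemma linear_ext (R : nzRingType) (U V : lmodType R) (f g : {linear U -> V}) :
  f =1 g -> f = g.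
Proof.
case: f g => [f cf] [g cg] /= /funext fg; case: _ / fg cg => cg.
congr GRing.Linear.Pack.
case: cf cg => [[f0] [f1]] [[g0] [g1]].
by rewrite (Prop_irrelevance f0 g0) (Prop_irrelevance f1 g1).
Qed.

Section JetGroupoid.
Variables (R : realType) (B : body_manifold R).

(* A 1-jet at X of a local diffeomorphism sending X to Y, identified with its
   tangent map, a linear isomorphism. *)
Record jet (X Y : B) := Jet {
  jet_map :> {linear tangent X -> tangent Y} ;
  jet_inv : {linear tangent Y -> tangent X} ;
  jet_mapK : cancel jet_map jet_inv ;
  jet_invK : cancel jet_inv jet_map }.

Lemma jet_ext (X Y : B) (f g : jet X Y) : f =1 g -> f = g.
Proof.
case: f g => [f f' fK f'K] [g g' gK g'K] /= fg.
have ? : f' = g' by apply: linear_ext => y; rewrite -{1}(g'K y) -fg fK.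
have ? : f = g by exact: linear_ext.
by subst g' g; congr Jet; exact: Prop_irrelevance.
Qed.

Definition jet_id (X : B) : jet X X :=
  @Jet X X idfun idfun (fun=> erefl) (fun=> erefl).

Definition jet_comp (X Y Z : B) (g : jet Y Z) (f : jet X Y) : jet X Z :=
  @Jet X Z (jet_map g \o jet_map f) (jet_inv f \o jet_inv g)
    (can_comp (jet_mapK g) (jet_mapK f)) (can_comp (jet_invK f) (jet_invK g)).

Definition jet_inverse (X Y : B) (f : jet X Y) : jet Y X :=
  Jet (jet_invK f) (jet_mapK f).

Definition jet_groupoid : groupoid B.
Proof.
apply: (@Groupoid B jet jet_id jet_comp jet_inverse) => *; apply: jet_ext => x //=.
- exact: jet_mapK.
- exact: jet_invK.
Defined.

End JetGroupoid.

(* The constitutive equations of a constituent are modelled by the response at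
   each point X, an element of a set [resp_space X] of conceivable responses of
   the first-order neighbourhood of X, together with the action by which jets
   carry responses from one point to another.  For instance, for a constitutive
   law psi (F, X) depending on the deformation gradient F, a linear isomorphism
   from T_X B to R^3 (or on several such gradients and further variables),
   [resp_space X] is the set of functions of F, the response at X is psi (-, X),
   and a jet P from X to Y carries s to the function F |-> s (F o P); then P is
   a material isomorphism iff psi (F o P, X) = psi (F, Y) for all F. *)
Record constituent (R : realType) (B : body_manifold R) := Constituent {
  resp_space : B -> Type ;
  carry : forall X Y, jet X Y -> resp_space X -> resp_space Y ;
  carry_id : forall X (s : resp_space X), carry (jet_id X) s = s ;
  carry_comp : forall X Y Z (g : jet Y Z) (f : jet X Y) (s : resp_space X),
    carry (jet_comp g f) s = carry g (carry f s) ;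
  response : forall X, resp_space X }.

Section Materials.
Variables (R : realType) (B : body_manifold R).

Definition material_isomorphism (C : constituent B) (X Y : B)
    : set (arr (jet_groupoid B) X Y) :=
  [set P | carry P (response C X) = response C Y].

Definition material_groupoid (C : constituent B) : subgroupoid (jet_groupoid B).
Proof.
apply: (@Subgroupoid _ _ (material_isomorphism C)) => [X|X Y Z g f|X Y f];
  rewrite /material_isomorphism /=.
- exact: carry_id.
- by move=> gC fC; rewrite carry_comp fC.
- move=> <-; rewrite -carry_comp.
  by rewrite (_ : jet_comp _ _ = jet_id X) ?carry_id//; exact: (gcompVl f).
Defined.

Definition materially_uniform (C : constituent B) : Prop :=
  is_transitive (material_groupoid C).

Definition mixture (n : nat) := 'I_n -> constituent B.

Definition mixture_isomorphism n (M : mixture n) (X Y : B)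
    : set (arr (jet_groupoid B) X Y) :=
  [set P | forall i, material_isomorphism (M i) P].

Definition mixture_materially_uniform n (M : mixture n) : Prop :=
  is_transitive (mixture_isomorphism M).

End Materials.

Definition vertex (n : nat) := {ffun 'I_n -> bool}.

Definition origin n : vertex n := [ffun=> false].

(* For v I = false this is v + e_I. *)
Definition raise n (v : vertex n) (I : 'I_n) : vertex n :=
  [ffun J => (J == I) || v J].

Section Skeletons.
Variables (B : Type) (G : groupoid B) (n : nat) (Z : 'I_n -> subgroupoid G).

Record skeleton := Skeleton {
  W : vertex n -> B ;
  edge : forall (I : 'I_n) (v : vertex n), v I = false ->
    arr G (W v) (W (raise v I)) ;
  edge_in : forall I (v : vertex n) (vI : v I = false), Z I _ _ (edge vI) }.

(* The proofs vIJ and vJI exist, and are unique, when I and J are distinct. *)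
Definition face_commutative (S : skeleton) (I J : 'I_n) (v : vertex n) : Prop :=
  forall (vI : v I = false) (vJ : v J = false)
         (vIJ : raise v I J = false) (vJI : raise v J I = false),
    bundle (gcomp (edge S vIJ) (edge S vI)) =
    bundle (gcomp (edge S vJI) (edge S vJ)).

Definition commutative_skeletons : set skeleton :=
  [set S | forall (I J : 'I_n) (v : vertex n),
     I != J -> v I = false -> v J = false -> face_commutative S I J v].

(* The arrows from X to Y of the core of an n-groupoid D of skeletons. *)
Definition core (D : set skeleton) (X Y : B) : set skeleton :=
  [set S | [/\ D S,
     forall I (v : vertex n) (vI : v I = false), v != origin n ->
       bundle (edge S vI) = bundle (gid G (W S v)),
     W S (origin n) = X &
     forall v, v != origin n -> W S v = Y]].

End Skeletons.

Arguments core {B G n Z} D X Y.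

Definition material_n_groupoid (R : realType) (B : body_manifold R) (n : nat)
    (M : mixture B n) : set (skeleton (fun I => material_groupoid (M I))) :=
  @commutative_skeletons B (jet_groupoid B) n (fun I => material_groupoid (M I)).

Arguments material_n_groupoid {R B n} M.

(* Main.v *)
Require Import Defs.
From mathcomp Require Import all_boot all_reals.

(** The equivalence holds separately for each pair of points X, Y, and over any
    groupoid G with n >= 1 subgroupoids Z_1, ..., Z_n: the core has an arrow
    from X to Y iff some arrow of G from X to Y lies in every Z_I
    ([core_arrow_iff_common_arrow]).

    An element of the core is determined by the n edges that issue from its
    origin.  In the face at the origin spanned by the directions I and J, the
    two edges opposite to the origin are units, so commutativity of that face
    says exactly that the edges at the origin in directions I and J are the
    same arrow ([core_edges_eq]).  Hence all n edges are one arrow g, and g lies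
    in Z_I because it is the weight of an edge in direction I, for every I.

    Conversely, an arrow g common to all Z_I gives a potential on the cube: the
    unit of X at the origin and g at every other vertex.  Weighting the edge
    v -> w by t_w o t_v^-1, where t is the potential, gives a skeleton whose
    faces commute because both ways around telescope to the same arrow
    ([potential_skeleton_commutative]); this arrow is a unit as soon as v is not
    the origin.

    For the jet groupoid and the material groupoids, the arrows that lie in all
    Z_I are the material isomorphisms of the mixture. *)

Set Implicit Arguments.
Unset Strict Implicit.
Unset Printing Implicit Defensive.

Lemma raise_neq_origin n (v : vertex n) (I : 'I_n) : raise v I != origin n.
Proof. by apply/eqP => /ffunP /(_ I); rewrite !ffunE eqxx. Qed.

Lemma raiseC n (v : vertex n) (I J : 'I_n) :
  raise (raise v I) J = raise (raise v J) I.
Proof. by apply/ffunP => K; rewrite !ffunE orbCA. Qed.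

Section Groupoids.
Variables (B : Type) (G : groupoid B).

(** The source and target of f need not be syntactically equal, so f cannot be
    replaced by a unit in the composite.  The property of acting trivially is
    therefore phrased for a bundled arrow and transported along the equality of
    bundles, which avoids any cast. *)
Lemma bundle_gcomp_unit (X Y Y' A : B) (f : arr G Y Y') (g : arr G X Y) :
  bundle f = bundle (gid G A) -> bundle (gcomp f g) = bundle g.
Proof.
move=> fA.
pose acts_trivially (p : {XY : B * B & arr G XY.1 XY.2}) :=
  forall h : arr G X (projT1 p).1, bundle (gcomp (projT2 p) h) = bundle h.
suff: acts_trivially (bundle f) by exact.
by rewrite fA => h /=; rewrite gcomp1l.
Qed.

Lemma subarr_bundle (H : subgroupoid G) (X Y X' Y' : B)
    (f : arr G X Y) (g : arr G X' Y') :
  bundle f = bundle g -> H _ _ f -> H _ _ g.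
Proof.
move=> fg.
pose in_H (p : {XY : B * B & arr G XY.1 XY.2}) := H _ _ (projT2 p).
by rewrite -[H _ _ f]/(in_H (bundle f)) fg.
Qed.

Variables (n : nat) (Z : 'I_n -> subgroupoid G).

Section Potential.
Variables (X : B) (W : vertex n -> B) (t : forall v, arr G X (W v)).
Hypothesis t_in : forall I v, Z I _ _ (t v).

Definition potential_skeleton : skeleton Z :=
  @Skeleton _ _ _ Z W (fun I v _ => gcomp (t (raise v I)) (ginv (t v)))
    (fun I v _ => sub_gcomp (t_in I (raise v I)) (sub_ginv (t_in I v))).

Lemma potential_skeleton_commutative :
  commutative_skeletons potential_skeleton.
Proof.
have telescope u v w : gcomp (gcomp (t w) (ginv (t v)))
    (gcomp (t v) (ginv (t u))) = gcomp (t w) (ginv (t u)).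
  by rewrite -gcompA [gcomp (ginv (t v)) _]gcompA gcompVl gcomp1l.
move=> I J v _ _ _ vI vJ vIJ vJI /=.
by rewrite !telescope raiseC.
Qed.

End Potential.

(** The boolean b tells whether a vertex is the origin.  Depending on the vertex
    through b alone lets the endpoints reduce once b is known. *)
Definition star_potential (X Y : B) (g : arr G X Y) (b : bool)
    : arr G X (if b then X else Y) :=
  if b is true then gid G X else g.

Lemma core_of_common_arrow (X Y : B) (g : arr G X Y) :
  (forall I, Z I _ _ g) ->
  exists S : skeleton Z, core (@commutative_skeletons _ _ _ Z) X Y S.
Proof.
move=> g_in.
have t_in I (v : vertex n) : Z I _ _ (star_potential g (v == origin n)).
  by case: (v == _) => /=; [exact: sub_gid | exact: g_in].
exists (potential_skeleton t_in).
split=> [|I v vI /negPf v0||v /negPf /= ->] //=.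
- exact: potential_skeleton_commutative.
- by rewrite (negPf (raise_neq_origin v I)) v0 /= gcompVr.
- by rewrite eqxx.
Qed.

(** Both sides are compared as bundles because their targets, the vertices
    e_I and e_J of the cube, are sent to the same point of B only
    propositionally. *)
Lemma core_edges_eq (X Y : B) (S : skeleton Z) (I J : 'I_n)
    (oI : origin n I = false) (oJ : origin n J = false) :
  core (@commutative_skeletons _ _ _ Z) X Y S ->
  bundle (edge S oI) = bundle (edge S oJ).
Proof.
case=> S_comm S_unit _ _.
have [IJ|IJ] := eqVneq I J.
  by case: _ / IJ oJ => oJ; rewrite (eq_irrelevance oI oJ).
have oIJ : raise (origin n) I J = false.
  by rewrite !ffunE eq_sym (negPf IJ).
have oJI : raise (origin n) J I = false by rewrite !ffunE (negPf IJ).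
have := S_comm I J _ IJ oI oJ oI oJ oIJ oJI.
by rewrite !(bundle_gcomp_unit _ (S_unit _ _ _ (raise_neq_origin _ _))).
Qed.

(** The lower bound on n matters: the 0-cube has no vertex besides the origin,
    so that Y is unconstrained and the left-hand side holds for all X and Y,
    whereas the right-hand side asks for an arrow of G from X to Y. *)
Lemma core_arrow_iff_common_arrow (X Y : B) : 0 < n ->
  (exists S : skeleton Z, core (@commutative_skeletons _ _ _ Z) X Y S) <->
  exists g : arr G X Y, forall I, Z I _ _ g.
Proof.
move=> n_gt0; split=> [[S S_core]|[g]]; last exact: core_of_common_arrow.
have o I : origin n I = false by rewrite ffunE.
pose I0 := Ordinal n_gt0.
have e_in I : Z I _ _ (edge S (o I0)).
  exact: subarr_bundle (core_edges_eq (o I) (o I0) S_core) (edge_in S (o I)).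
case: S_core => _ _ <- /(_ _ (raise_neq_origin (origin n) I0)) <-.
by exists (edge S (o I0)).
Qed.

End Groupoids.

Theorem corollary4p1 (R : realType) (B : body_manifold R) (n : nat)
    (n_ge1 : (1 <= n)%N) (M : mixture B n)
    (M_uniform : forall i : 'I_n, materially_uniform (M i)) :
  mixture_materially_uniform M <-> is_transitive (core (material_n_groupoid M)).
Proof.
have core_iff X Y :=
  core_arrow_iff_common_arrow (fun I => material_groupoid (M I)) X Y n_ge1.
by split=> trans X Y; apply/core_iff; exact: trans.
Qed.
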